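(* Let $f:\mathbb R^d\to\mathbb R$ be differentiable, $\theta_0\in\mathbb R^d$, $\rho\in[0,1)$ and $\lambda>0$. Let $(\theta_k)_{k\ge 0}$ be iterates with $\theta_{k+1}=\theta_k+s_k$, let $g_k:=\nabla f(\theta_k)$, and for each $k\ge 0$ let $B_k\in\mathbb R^{d\times d}$ be an arbitrary symmetric positive definite matrix (chosen at iterate $\theta_k$). Suppose that for every $k\ge 0$ the step $s_k$ is the WoQM (Wake of Quadratic Models) step at $\theta_k$, i.e. the solution of $$\min_{s\in\mathbb R^d}\ \sum_{i=0}^k\rho^{k-i}M^{(Q)}_i\Bigl(s+\sum_{j=i}^{k-1}s_j\Bigr),\qquad M^{(Q)}_i(s):=g_i^Ts+\frac{\lambda_i}{2}s^TB_is,$$ where $\lambda_0=\lambda$ and $\lambda_i=(1-\rho)\lambda$ for $i\ge 1$. Then for every integer $k\ge 0$, $$s_k=-\lambda^{-1}\bar B_k^{-1}g_k,\qquad\text{where}\quad \bar B_k:=\rho^kB_0+(1-\rho)\sum_{i=1}^k\rho^{k-i}B_i .$$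
   Context: Conventions: empty sums are zero, in particular $\sum_{j=k}^{k-1}s_j=0$; $\rho^0=1$ also when $\rho=0$. The steps are defined recursively: the minimization problem defining $s_k$ involves the previously computed steps $s_0,\dots,s_{k-1}$, the gradients $g_0,\dots,g_k$ and the matrices $B_0,\dots,B_k$. The matrix $B_k$ may depend on everything available at iteration $k$ (but not on the variable $s$). *)

(* Defs.v *)
From mathcomp Require Import all_boot all_order all_algebra.
From mathcomp Require Import all_classical all_reals all_analysis.

Set Implicit Arguments.
Unset Strict Implicit.
Unset Printing Implicit Defensive.

Import Order.TTheory GRing.Theory Num.Theory.
Import numFieldNormedType.Exports.

Local Open Scope ring_scope.

(* The vector of partial derivatives; for f differentiable at x it is the
   vector representing the differential of f at x. *)
Definition gradient (R : realType) (d : nat) (f : 'cV[R]_d -> R)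
    (x : 'cV[R]_d) : 'cV[R]_d :=
  \col_(i < d) 'D_(delta_mx i 0 : 'cV[R]_d) f x.

Definition sym_posdef (R : realType) (d : nat) (B : 'M[R]_d) : Prop :=
  B^T = B /\ forall x : 'cV[R]_d, x != 0 -> 0 < (x^T *m B *m x) 0 0.

Definition quad_model (R : realType) (d : nat) (lam : R) (g : 'cV[R]_d)
    (B : 'M[R]_d) (s : 'cV[R]_d) : R :=
  (g^T *m s) 0 0 + lam / 2 * (s^T *m B *m s) 0 0.

Definition woqm_lambda (R : realType) (rho lam : R) (i : nat) : R :=
  if i == 0%N then lam else (1 - rho) * lam.

(* Only the values s j with j < k are used. *)
Definition woqm_objective (R : realType) (d : nat) (rho lam : R)
    (g : nat -> 'cV[R]_d) (B : nat -> 'M[R]_d) (s : nat -> 'cV[R]_d)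
    (k : nat) (x : 'cV[R]_d) : R :=
  \sum_(0 <= i < k.+1)
    rho ^+ (k - i) *
      quad_model (woqm_lambda rho lam i) (g i) (B i)
        (x + \sum_(i <= j < k) s j).

Definition minimizes (R : realType) (T : Type) (F : T -> R) (x : T) : Prop :=
  forall y : T, F x <= F y.

Definition woqm_Bbar (R : realType) (d : nat) (rho : R)
    (B : nat -> 'M[R]_d) (k : nat) : 'M[R]_d :=
  rho ^+ k *: B 0%N
    + (1 - rho) *: \sum_(1 <= i < k.+1) rho ^+ (k - i) *: B i.

(* Main.v *)
(** The gradient of the WoQM objective satisfies
    [grad_(k+1) x = rho grad_k (x + s_k) + g_(k+1) + (1 - rho) lambda B_(k+1) x].
    It is affine with linear part [lambda Bbar_k], and it vanishes at the
    minimizer [s_k], so [grad_k (x + s_k) = lambda Bbar_k x]. The whole history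
    therefore collapses to [grad_k x = g_k + lambda Bbar_k x] for [k >= 0], and
    the formula for [s_k] is the equation [grad_k s_k = 0]. *)
Require Import Defs.
From mathcomp Require Import all_boot all_order all_algebra.
From mathcomp Require Import all_classical all_reals all_analysis.
From mathcomp Require Import ring lra.
Import Order.TTheory GRing.Theory Num.Theory.
Import numFieldNormedType.Exports.
Local Open Scope ring_scope.

(** Near [t = 0] the linear term dominates, whatever the sign of [c], so a nonzero [a] would make
    the expression negative for some [t]. *)
Lemma quadratic_ge0_linear_coef0 {R : realFieldType} (a c : R) :
  (forall t, 0 <= t * a + t ^+ 2 * c) -> a = 0.
Proof.
move=> h; apply/eqP; apply: contraT => a0.
(* Any positive [m > c] would do: at [t = - a / m] the value is [a ^+ 2 / m ^+ 2 * (c - m)]. *)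
pose m := 1 + `|c|.
have m0 : 0 < m by rewrite ltr_pwDl.
have a2 : 0 < a ^+ 2 by rewrite exprn_even_gt0.
have := h (- a / m).
have -> : - a / m * a + (- a / m) ^+ 2 * c = a ^+ 2 / m ^+ 2 * (c - m).
  by field; rewrite gt_eqF.
rewrite pmulr_rge0; last by rewrite divr_gt0 // exprn_gt0.
by move: (ler_norm c); rewrite /m; lra.
Qed.

(** A row [v] with [v B = 0] gives [v B v^T = 0], so positivity forces [v = 0] and the left kernel
    is trivial. *)
Lemma sym_posdef_unitmx {R : realType} {d : nat} {B : 'M[R]_d} :
  sym_posdef B -> B \in unitmx.
Proof.
case=> _ Bpos; rewrite -row_free_unit -kermx_eq0.
apply/eqP/row_matrixP => i; rewrite row0; apply/eqP; apply: contraT => v0.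
have := Bpos (row i (kermx B))^T; rewrite trmxK -row_mul mulmx_ker row0 mul0mx.
by rewrite mxE ltxx => ->//; rewrite trmx_eq0.
Qed.

Lemma woqm_Bbar0 {R : realType} {d : nat} (rho : R) (B : nat -> 'M[R]_d) :
  woqm_Bbar rho B 0 = B 0%N.
Proof. by rewrite /woqm_Bbar big_geq// scaler0 addr0 expr0 scale1r. Qed.

Lemma woqm_BbarS {R : realType} {d : nat} (rho : R) (B : nat -> 'M[R]_d) k :
  woqm_Bbar rho B k.+1 = rho *: woqm_Bbar rho B k + (1 - rho) *: B k.+1.
Proof.
rewrite /woqm_Bbar big_nat_recr//= subnn expr0 scale1r !scalerDr addrA.
congr (_ + _ + _); first by rewrite scalerA exprS.
rewrite scalerA mulrC -scalerA; congr (_ *: _); rewrite scaler_sumr.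
by apply: eq_big_nat => i /andP[_ ik]; rewrite scalerA -exprS subSn.
Qed.

Lemma sym_posdef_woqm_Bbar {R : realType} {d : nat} (rho : R)
    (B : nat -> 'M[R]_d) k :
  0 <= rho -> rho < 1 -> (forall i, sym_posdef (B i)) ->
  sym_posdef (woqm_Bbar rho B k).
Proof.
move=> rho0 rho1 Bspd; elim: k => [|k [IHs IHp]]; first by rewrite woqm_Bbar0.
have [Bs Bp] := Bspd k.+1; rewrite woqm_BbarS; split.
  by rewrite linearD/= !linearZ/= IHs Bs.
move=> x x0; rewrite mulmxDr mulmxDl -!scalemxAr -!scalemxAl mxE.
have scaleE (a : R) (M : 'M[R]_1) : (a *: M) 0 0 = a * M 0 0 by rewrite mxE.
rewrite !scaleE.
(* Since [rho] may be 0, strict positivity has to come from the [B k.+1] term, whose weight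
   [1 - rho] is positive. *)
apply: ltr_wpDl; first by rewrite mulr_ge0// ltW// IHp.
by rewrite mulr_gt0 ?subr_gt0 ?Bp.
Qed.

(** This is the exact Taylor expansion along a line; symmetry of [B] merges the two cross terms into
    one. *)
Lemma quad_modelD {R : realType} {d : nat} (lam t : R) (g : 'cV[R]_d)
    (B : 'M[R]_d) (y v : 'cV[R]_d) : B^T = B ->
  quad_model lam g B (y + t *: v) =
    quad_model lam g B y + t * (v^T *m (g + lam *: (B *m y))) 0 0
      + t ^+ 2 * (lam / 2 * (v^T *m B *m v) 0 0).
Proof.
move=> Bs.
have tr11 (M : 'M[R]_1) : M^T 0 0 = M 0 0 by rewrite mxE.
have addE (M N : 'M[R]_1) : (M + N) 0 0 = M 0 0 + N 0 0 by rewrite mxE.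
have scaleE (a : R) (M : 'M[R]_1) : (a *: M) 0 0 = a * M 0 0 by rewrite mxE.
have gv : (v^T *m g) 0 0 = (g^T *m v) 0 0.
  by rewrite -tr11 trmx_mul trmxK.
have Bv : (y^T *m B *m v) 0 0 = (v^T *m B *m y) 0 0.
  by rewrite -tr11 !trmx_mul trmxK Bs mulmxA.
rewrite /quad_model [(y + _)^T]linearD/= [(t *: v)^T]linearZ/= !mulmxDl !mulmxDr.
rewrite -!scalemxAr -!scalemxAl -?scalemxAr mulmxA.
by rewrite !addE !scaleE gv Bv; field.
Qed.

(** The gradient of [woqm_objective] in closed form, so that the argument stays algebraic and no
    derivative is taken. *)
Definition woqm_gradient {R : realType} {d : nat} (rho lam : R)
    (g : nat -> 'cV[R]_d) (B : nat -> 'M[R]_d) (s : nat -> 'cV[R]_d)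
    (k : nat) (x : 'cV[R]_d) : 'cV[R]_d :=
  \sum_(0 <= i < k.+1)
    rho ^+ (k - i) *:
      (g i + woqm_lambda rho lam i *: (B i *m (x + \sum_(i <= j < k) s j))).

Section Gradient.
Context {R : realType} {d : nat} (rho lam : R).
Context (g : nat -> 'cV[R]_d) (B : nat -> 'M[R]_d) (s : nat -> 'cV[R]_d).

Local Notation grad := (woqm_gradient rho lam g B s).

Lemma woqm_gradient0 x : grad 0 x = g 0%N + lam *: (B 0%N *m x).
Proof.
by rewrite /woqm_gradient big_nat1 big_geq// addr0 expr0 scale1r.
Qed.

(** From [k] to [k.+1], each older model gains one factor [rho] and the summand [s k] in its shift;
    the new model has weight 1 and an empty shift. *)
Lemma woqm_gradientS k x :
  grad k.+1 x =
    rho *: grad k (x + s k) + (g k.+1 + ((1 - rho) * lam) *: (B k.+1 *m x)).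
Proof.
rewrite /woqm_gradient big_nat_recr//= subnn expr0 scale1r.
rewrite [\sum_(k.+1 <= j < k.+1) _]big_geq// addr0; congr (_ + _).
rewrite scaler_sumr; apply: eq_big_nat => i /andP[_ ik].
rewrite scalerA -exprS -subSn//; congr (_ *: (_ + _ *: (_ *m _))).
by rewrite big_nat_recr// -addrA [s k + _]addrC.
Qed.

(** Translating the base point by [s k] leaves the linear part unchanged, so that part obeys the
    same recursion as [woqm_Bbar]. *)
Lemma woqm_gradientD k x y :
  grad k (x + y) = grad k x + lam *: (woqm_Bbar rho B k *m y).
Proof.
elim: k x y => [|k IH] x y.
  by rewrite !woqm_gradient0 woqm_Bbar0 mulmxDr scalerDr addrA.
rewrite !woqm_gradientS woqm_BbarS [x + y + _]addrAC (IH (x + s k)).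
rewrite [(rho *: _ + _) *m _]mulmxDl [B k.+1 *m (_ + _)]mulmxDr.
rewrite -!scalemxAl !scalerDr !scalerA [rho * lam]mulrC [(1 - rho) * lam]mulrC.
by rewrite [g k.+1 + _]addrA addrACA.
Qed.

(** Along each direction [v] the objective is a quadratic in [t], minimal at [t = 0], with linear
    coefficient the pairing of [v] with the gradient. *)
Lemma minimizes_woqm_gradient k x : (forall i, (B i)^T = B i) ->
  minimizes (woqm_objective rho lam g B s k) x -> grad k x = 0.
Proof.
move=> Bs xmin.
have scaleE (a : R) (M : 'M[R]_1) : (a *: M) 0 0 = a * M 0 0 by rewrite mxE.
have crit (v : 'cV[R]_d) : (v^T *m grad k x) 0 0 = 0.
  apply: (@quadratic_ge0_linear_coef0 _ _ (\sum_(0 <= i < k.+1)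
    rho ^+ (k - i) * (woqm_lambda rho lam i / 2 * (v^T *m B i *m v) 0 0))) => t.
  suff expand : woqm_objective rho lam g B s k (x + t *: v) =
      woqm_objective rho lam g B s k x + (t * (v^T *m grad k x) 0 0 +
      t ^+ 2 * \sum_(0 <= i < k.+1) rho ^+ (k - i) *
        (woqm_lambda rho lam i / 2 * (v^T *m B i *m v) 0 0)).
    by have := xmin (x + t *: v); rewrite expand lerDl.
  rewrite /woqm_objective /woqm_gradient mulmx_sumr summxE !mulr_sumr.
  rewrite -!big_split/=; apply: eq_bigr => i _.
  by rewrite addrAC quad_modelD// -scalemxAr scaleE; ring.
apply/colP => i; rewrite [RHS]mxE -(crit (delta_mx i 0)).
by rewrite trmx_delta -rowE mxE.
Qed.

End Gradient.

Theorem proposition3p1 (R : realType) (d : nat) (f : 'cV[R]_d -> R)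
    (rho lam : R) (theta s g : nat -> 'cV[R]_d) (B : nat -> 'M[R]_d)
    (f_diff : forall x : 'cV[R]_d, differentiable f x)
    (rho_ge0 : 0 <= rho) (rho_lt1 : rho < 1) (lam_gt0 : 0 < lam)
    (thetaS : forall k : nat, theta k.+1 = theta k + s k)
    (gE : forall k : nat, g k = gradient f (theta k))
    (B_spd : forall k : nat, sym_posdef (B k))
    (s_woqm : forall k : nat, minimizes (woqm_objective rho lam g B s k) (s k)) :
  forall k : nat,
    woqm_Bbar rho B k \in unitmx /\
    s k = - (lam^-1 *: (invmx (woqm_Bbar rho B k) *m g k)).
Proof.
move=> k.
have Bbar_unit := sym_posdef_unitmx
  (sym_posdef_woqm_Bbar _ _ k rho_ge0 rho_lt1 B_spd).
have grad0 j : woqm_gradient rho lam g B s j (s j) = 0.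
  by apply: minimizes_woqm_gradient => // i; case: (B_spd i).
have gradE : woqm_gradient rho lam g B s k (s k) =
    g k + lam *: (woqm_Bbar rho B k *m s k).
  (* Index 0 has no history. At [k.+1], the older models are expanded around their own minimizer
     [s k], where their gradient vanishes. *)
  case: k {Bbar_unit} => [|k]; first by rewrite woqm_gradient0 woqm_Bbar0.
  rewrite woqm_gradientS [s k.+1 + s k]addrC woqm_gradientD grad0 add0r.
  rewrite addrCA woqm_BbarS [(rho *: _ + _) *m _]mulmxDl -!scalemxAl scalerDr !scalerA.
  by rewrite [rho * lam]mulrC [(1 - rho) * lam]mulrC.
split=> //; move: gradE; rewrite grad0 => /esym/eqP.
rewrite addr_eq0 => /eqP ->.
by rewrite mulmxN -scalemxAr mulKmx// scalerN opprK scalerA mulVf ?scale1r// gt_eqF.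
Qed.
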